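(* Let $m,\delta\in\mathbb N=\{1,2,\ldots\}$, and consider additive wall subtraction with subtraction set $S(m,\delta)=\{m,\;m+\delta,\;2m+\delta\}$. Let $d$ be the residue of $\delta$ modulo $2m$ with $0\le d<2m$. Then the period length of the outcome sequence $(o_{\rm wall}(x))_{x\ge 0}$ is $$p(m,\delta)=\begin{cases}3m+2\delta-d, & \text{if } 0\le d\le m,\\[2pt] \dfrac{m(m+2\delta+d)}{\gcd(m,d)}, & \text{otherwise (i.e. if } m<d<2m).\end{cases}$$
   Context: Wall subtraction with finite subtraction set $S\subset\mathbb N$ is the classical subtraction game: a two-player impartial game under normal play (a player who cannot move loses) whose positions are the non-negative integers, and where from position $x\ge 0$ the options are $x-s$ for those $s\in S$ with $x-s\ge 0$ (moves to negative integers are forbidden). The outcome $o_{\rm wall}(x)\in\{\mathcal P,\mathcal N\}$ of position $x$ is $\mathcal P$ if the previous player (the one not to move) wins under optimal play, and $\mathcal N$ if the current player wins. Equivalently, $o_{\rm wall}(x)=\mathcal P$ if and only if no option of $x$ has outcome $\mathcal P$. The outcome sequence of a finite subtraction set is eventually periodic; its period length is the least integer $p\ge1$ such that $o_{\rm wall}(x+p)=o_{\rm wall}(x)$ for all sufficiently large $x$. *)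

(* Defs.v *)
From mathcomp Require Import all_boot.
Set Implicit Arguments.
Unset Strict Implicit.
Unset Printing Implicit Defensive.

(* A finite subtraction set is given by a list of its elements; only membership
   matters.  The game is meant for sets of positive integers, [0 \notin S]. *)
Definition wall_options (S : seq nat) (x : nat) : seq nat :=
  [seq x - s | s <- S & s <= x].

Inductive outcome : Set :=
  | Pout (* the previous player wins *)
  | Nout (* the current player wins *).

Definition is_Pout (o : outcome) : bool := if o is Pout then true else false.

(* The argument [n] only bounds the recursion depth: when [0 \notin S] every
   option of [x] is smaller than [x], so any [n > x] gives the same value (see
   [o_wallP]). *)
Fixpoint o_wall_rec (S : seq nat) (n x : nat) : outcome :=
  if n is n'.+1 then
    if has (fun y => is_Pout (o_wall_rec S n' y)) (wall_options S x)
    then Nout else Pout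
  else Pout.

Definition o_wall (S : seq nat) (x : nat) : outcome := o_wall_rec S x.+1 x.

Definition eventual_period (T : Type) (f : nat -> T) (p : nat) : Prop :=
  1 <= p /\ exists x0, forall x, x0 <= x -> f (x + p) = f x.

Definition is_period_length (T : Type) (f : nat -> T) (p : nat) : Prop :=
  eventual_period f p /\ forall q, eventual_period f q -> p <= q.

Definition S_additive (m delta : nat) : seq nat :=
  [:: m; m + delta; 2 * m + delta].

(* [d] is the residue of [delta] modulo [2 * m].  Both the subtraction
   ([d <= delta]) and the division ([gcdn m d] divides [m]) are exact. *)
Definition additive_period (m delta : nat) : nat :=
  let d := delta %% (2 * m) in
  if d <= m then 3 * m + 2 * delta - d
  else (m * (m + 2 * delta + d)) %/ gcdn m d.

Lemma wall_options_lt S x y : 0 \notin S -> y \in wall_options S x -> y < x.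
Proof.
move=> S0 /mapP[s]; rewrite mem_filter => /andP[sx sS] ->.
have s_gt0 : 0 < s by rewrite lt0n; apply: contraNneq S0 => <-.
by rewrite ltn_subrL s_gt0 (leq_trans s_gt0 sx).
Qed.

Lemma o_wall_recE S n x : 0 \notin S -> x < n -> o_wall_rec S n x = o_wall S x.
Proof.
move=> S0; suff H k : forall n1 n2 y, y < k -> y < n1 -> y < n2 ->
    o_wall_rec S n1 y = o_wall_rec S n2 y.
  by move=> xn; apply: (H x.+1).
elim: k => [//|k IH] [//|n1] [//|n2] y; rewrite !ltnS => yk y1 y2 /=.
rewrite (@eq_in_has _ _ (fun z => is_Pout (o_wall_rec S n2 z))) // => z.
move=> /(wall_options_lt S0) zy.
by rewrite (IH n1 n2) // (leq_trans zy).
Qed.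

Lemma o_wallP S x : 0 \notin S ->
  o_wall S x = Pout <-> (forall y, y \in wall_options S x -> o_wall S y <> Pout).
Proof.
move=> S0; rewrite {1}/o_wall /=; set h := has _ _.
have hE : h = has (fun y => is_Pout (o_wall S y)) (wall_options S x).
  by apply: eq_in_has => y /(wall_options_lt S0) yx; rewrite o_wall_recE.
rewrite {}hE {h}; split=> [|noP]; last first.
  case: hasP => // -[y yx Py].
  by case: (noP y yx); case: (o_wall S y) Py.
by case: hasP => // noP _ y yx Py; apply: noP; exists y; rewrite ?Py.
Qed.

(* Main.v *)
Require Import Defs.
From mathcomp Require Import all_boot.
From mathcomp Require Import zify.

(** Put [a = m] and [b = m + delta], so that the moves are [a], [b], [a + b].
    The outcome sequence falls into cycles.  Each consists of an active part, in
    which blocks of [a] P-positions and [a] N-positions alternate, and of a run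
    of N-positions; its phase [f < a] is the number of P-positions missing from
    its first block.

    If [b = (2 k + 1) a + d] with [d <= a], every cycle is of phase 0 and
    has an active part of length [b - d] and a run of length [a + b].

    If [b = 2 h a + e] with [0 < e < a], a cycle of phase [f] has an
    active part of length [b] when [f + e < a] and [b + a] otherwise, followed
    by a run of length [b], and the next phase is [f + e] modulo [a].  So cycle
    number [j] starts at [2 b j + a floor(j e / a)] with phase [j e mod a], and
    the phase first returns to 0 after [a / gcd(a, e)] cycles.

    Conversely the outcomes determine where the cycles of phase 0 start: a cycle
    starts exactly at a P-position that follows a run of N-positions, and its
    first block has length [a - f]. *)

(** If [q] is a period from [x0] on, the shift by [x0 * p + q] fixes the whole sequence, so [p]
    divides it and hence divides [q]. *)
Lemma is_period_lengthI (T : Type) (f : nat -> T) (p : nat) :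
  0 < p -> (forall x, f (x + p) = f x) ->
  (forall x, (forall i, f (x + i) = f i) -> p %| x) ->
  is_period_length f p.
Proof.
move=> p_gt0 fp fdvd; split=> [|q [q_gt0 [x0 fq]]]; first by split=> //; exists 0.
have fMp k i : f (k * p + i) = f i.
  elim: k => [|k IHk]; first by rewrite mul0n.
  by rewrite mulSn -addnA addnC fp.
have : p %| x0 * p + q.
  apply: fdvd => i; rewrite -addnA (addnC q) addnA fq ?fMp //.
  by apply: leq_trans (leq_addr _ _); apply: leq_pmulr.
by rewrite dvdn_addr ?dvdn_mull //; apply: dvdn_leq.
Qed.

(** * Alternating blocks of length [a] *)

Definition even_block (a t : nat) : bool := ~~ odd (t %/ a).

Section EvenBlock.
Variable a : nat.
Hypothesis a_gt0 : 0 < a.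

Lemma even_blockD t : even_block a (t + a) = ~~ even_block a t.
Proof. by rewrite /even_block divnDr ?dvdnn // divnn a_gt0 addn1. Qed.

Lemma even_blockB t : a <= t -> even_block a (t - a) = ~~ even_block a t.
Proof. by move=> le_at; rewrite -{2}(subnK le_at) even_blockD negbK. Qed.

Lemma even_blockDM k t : even_block a (t + k * a) = even_block a t (+) odd k.
Proof.
elim: k => [|k IHk]; first by rewrite addn0 addbF.
by rewrite mulSn (addnC a) addnA even_blockD IHk -addbN.
Qed.

Lemma even_block_lt2 t : t < 2 * a -> even_block a t = (t < a).
Proof.
case: (ltnP t a) => [lt_ta _|le_at lt_t2a]; first by rewrite /even_block divn_small.
by rewrite -[even_block a t]negbK -even_blockB // /even_block divn_small //; lia.
Qed.

End EvenBlock.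

Section AdditiveGame.
Variables (a b : nat) (P : pred nat).

Definition P_option (s x : nat) : bool := (s <= x) && P (x - s).

Hypothesis a_gt0 : 0 < a.
Hypothesis P_rec :
  forall x, P x = ~~ [|| P_option a x, P_option b x | P_option (a + b) x].

Lemma P_optionDl s t x : P_option s x = P_option (s + t) (x + t).
Proof. by rewrite /P_option leq_add2r subnDr. Qed.

Lemma P_optionE s x y : x = y + s -> P_option s x = P y.
Proof. by move=> ->; rewrite /P_option leq_addl addnK. Qed.

(** * Residue at most [a]: cycles of phase 0 *)

Section SmallResidue.
Variables (k d : nat).
Hypothesis d_le : d <= a.
Hypothesis bE : b = (2 * k).+1 * a + d.
Let c := (2 * k).+1 * a.
Let p := a + b + c.

(* Nothing below [T] is a P-position within reach of [T]. *)
Definition clear_before T := forall y, y < a + b -> P_option (a + b) (T + y) = false.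

(** As [c] is an odd multiple of [a], the last block before it has even index. *)
Lemma even_block_before_c y : y < c -> c <= y + a -> even_block a y.
Proof.
move=> lt_yc le_cy; have lt_y : y - 2 * k * a < a by rewrite /c in lt_yc le_cy *; nia.
rewrite -(@subnK (2 * k * a) y); last by rewrite /c in le_cy; nia.
by rewrite even_blockDM // oddM addbF /even_block divn_small.
Qed.

(** Below [c] only the move [a] can reach a P-position. From [c] on some move always does: [a] up to
    [c + a], then [b] or [a + b] up to [b + c], then [a + b] into the last block. Since [d <= a],
    the move [b] stays inside the cycle as soon as [y >= c + a]. *)
Lemma small_cycle T : clear_before T ->
  forall y, y < p -> P (T + y) = (y < c) && even_block a y.
Proof.
move=> clrT; have bcd : b = c + d by []; have le_ac : a <= c by rewrite /c; nia.
elim/ltn_ind=> y IHy lt_yp; rewrite P_rec.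
have [lt_yc|le_cy] := ltnP y c.
  (* [P_optionDl] rewrites the move [b] from [y] as the move [a + b] from [y + a], so that [clrT]
     covers it. *)
  rewrite (clrT y) 1?(P_optionDl b a) 1?(addnC b) -?addnA ?(clrT (y + a)); [|lia..].
  rewrite /= !orbF; have [lt_ya|le_ay] := ltnP y a.
    rewrite (P_optionDl a b) -addnA clrT; last lia.
    by rewrite /even_block divn_small.
  rewrite (P_optionE a _ (T + (y - a))); last lia.
  rewrite IHy; [|lia..].
  by rewrite even_blockB // (_ : y - a < c) ?negbK //; lia.
apply/negbTE; rewrite negbK.
have [lt_yca|le_cay] := ltnP y (c + a).
  rewrite (P_optionE a _ (T + (y - a))); last lia.
  by rewrite IHy ?even_block_before_c ?andbT; lia.
have Pab : a + b <= y -> even_block a (y - (a + b)) -> P_option (a + b) (T + y).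
  move=> le_aby ev; rewrite (P_optionE _ _ (T + (y - (a + b)))); last lia.
  by rewrite IHy ?ev ?andbT; rewrite /p in lt_yp *; lia.
have [lt_ybc|le_bcy] := ltnP y (b + c); last first.
  by rewrite Pab ?orbT //; [lia | rewrite even_block_before_c //; rewrite /p in lt_yp; lia].
rewrite (P_optionE b _ (T + (y - b))); last lia.
rewrite IHy; [|lia..]; rewrite (_ : y - b < c) /=; last lia.
have [ev|nev] := boolP (even_block a (y - b)); first by rewrite orbT.
have le_ayb : a <= y - b.
  by rewrite leqNgt; apply: contra nev => lt; rewrite /even_block divn_small.
rewrite Pab ?orbT //; first lia.
by rewrite addnC subnDA even_blockB.
Qed.

Lemma small_clear j : clear_before (j * p).
Proof.
elim: j => [|j IHj] y lt_y.
  by rewrite mul0n /P_option leqNgt lt_y.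
rewrite (P_optionE _ _ (j * p + (c + y))); last by rewrite mulSn /p; lia.
rewrite small_cycle //; last by rewrite /p; lia.
by rewrite ltnNge leq_addr.
Qed.

Lemma small_P j y : y < p -> P (j * p + y) = (y < c) && even_block a y.
Proof. exact/small_cycle/small_clear. Qed.

Lemma small_period_length : is_period_length P p.
Proof.
have p_gt0 : 0 < p by rewrite /p; lia.
have c_gt0 : 0 < c by rewrite /c muln_gt0.
have le_cb : c <= b by rewrite bE leq_addr.
have P0 j : P (j * p) by rewrite -[j * p]addn0 small_P // c_gt0 /even_block div0n.
apply: is_period_lengthI => // x.
  by rewrite (divn_eq x p) addnAC -mulSnr !small_P ?ltn_pmod.
move=> Px; apply: contraT; rewrite /dvdn -lt0n => y_gt0.
have := ltn_pmod x p_gt0; set y := x %% p in y_gt0 * => lt_yp.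
have : P (0 * p + y).
  rewrite small_P // -(small_P (x %/ p)) // /y -divn_eq.
  by have := Px 0; rewrite addn0 => ->; rewrite -(mul0n p).
rewrite small_P // => /andP[lt_yc _].
(* The shift by [x] sends [p - y] to a cycle start, so [p - y] would be a P-position below [c]; but
   [y < c <= b] gives [c <= p - y]. *)
have := Px (p - y); rewrite {1}(divn_eq x p) -addnA subnKC; last by rewrite ltnW.
rewrite -mulSnr P0 -[p - y]add0n -{1}(mul0n p) small_P; last lia.
by rewrite ltnNge (_ : c <= p - y) //; rewrite /p; lia.
Qed.

End SmallResidue.

(** * Residue above [a]: cycles of varying phase *)

Section LargeResidue.
Variables (h e : nat).
Hypothesis h_gt0 : 0 < h.
Hypothesis e_gt0 : 0 < e.
Hypothesis e_lt : e < a.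
Hypothesis bE : b = 2 * h * a + e.

Lemma even_blockDb t : even_block a (t + b) = even_block a (t + e).
Proof. by rewrite bE (addnC _ e) addnA even_blockDM // oddM addbF. Qed.

Lemma le_2a_b : 2 * a <= b. Proof. by rewrite bE; nia. Qed.

(* What the options see when a cycle is entered at [T] with phase [f]: a run of
   [b] N-positions, preceded by the last block of the previous active part. *)
Definition enters T f :=
  (forall y, y < b -> P_option b (T + y) = false) /\
  (forall y, y < a -> P_option (a + b) (T + y) = (a <= f + y)).

Definition active_length f := if f + e < a then b else b + a.

Lemma large_cycle T f : f < a -> enters T f ->
  forall y, y < active_length f + b ->
    P (T + y) = (y < active_length f) && even_block a (f + y).
Proof.
move=> lt_fa [run prev]; have le2ab := le_2a_b.
elim/ltn_ind=> y IHy lt_y; rewrite P_rec.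
have [lt_bL gt_bL] : b <= active_length f /\ active_length f <= b + a.
  by rewrite /active_length; case: ifP; lia.
have Pa : a <= y < a + active_length f ->
    P_option a (T + y) = ~~ even_block a (f + y).
  move=> le_ay; rewrite (P_optionE a _ (T + (y - a))); last lia.
  rewrite IHy; [|lia..]; rewrite (_ : y - a < _); last lia.
  by rewrite addnBA ?even_blockB //; lia.
have Pb : b <= y < b + active_length f ->
    P_option b (T + y) = even_block a (f + (y - b)).
  move=> le_by; rewrite (P_optionE b _ (T + (y - b))); last lia.
  rewrite IHy; [|lia..]; by rewrite (_ : y - b < _); last lia.
have Pab : a + b <= y < a + b + active_length f ->
    P_option (a + b) (T + y) = ~~ even_block a (f + (y - b)).
  move=> le_aby; rewrite (P_optionE _ _ (T + (y - (a + b)))); last lia.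
  rewrite IHy; [|lia..]; rewrite (_ : y - (a + b) < _) /=; last lia.
  by rewrite -even_blockB //; [congr even_block|]; lia.
(* The move [a + b] from [y] lands where the move [b] from [y - a] does. *)
have runab : a <= y < a + b -> P_option (a + b) (T + y) = false.
  move=> le_ay; rewrite -(run (y - a)); last lia.
  by rewrite (P_optionDl b a) (addnC b); congr P_option; lia.
have [lt_ya|le_ay] := ltnP y a.
  rewrite run ?prev //; last lia.
  rewrite (P_optionDl a (b - a)) (_ : a + (b - a) = b); last lia.
  rewrite -addnA run; last lia.
  rewrite (_ : y < active_length f) /=; last lia.
  by rewrite even_block_lt2 //; lia.
have [lt_yb|le_by] := ltnP y b.
  rewrite run // runab; last lia.
  rewrite Pa; last lia.
  by rewrite !orbF negbK (_ : y < active_length f) //; lia.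
have fyE : even_block a (f + y) = even_block a (f + (y - b) + e).
  by rewrite -even_blockDb; congr even_block; lia.
have [lt_yL|le_Ly] := ltnP y (active_length f).
  have lt_yba : y < b + a by lia.
  have wrap : a <= f + e.
    by move: lt_yL; rewrite /active_length; case: (ltnP (f + e)) => // _; lia.
  rewrite runab; last lia.
  rewrite Pa; last lia.
  rewrite Pb; last lia.
  (* The [a] and [b] options are both N on an even block: if [f + (y - b) < a], then adding [e]
     leads into the odd block, because [a <= f + e]. *)
  rewrite orbF negb_or negbK /= andbC.
  have [|//] := boolP (even_block a (f + (y - b))).
  rewrite even_block_lt2 // => [lt|]; last lia.
  by rewrite fyE even_block_lt2 //; lia.
apply/negbTE; rewrite negbK.
rewrite Pb; last lia.
have [//|nev] := boolP (even_block a (f + (y - b))); first by rewrite orbT.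
have [le_aby|lt_yab] := leqP (a + b) y.
  by rewrite Pab ?(negbTE nev) ?orbT //; lia.
have nowrap : f + e < a.
  by move: le_Ly; rewrite /active_length; case: (ltnP (f + e)) => // _; lia.
(* Dually, an offset in the odd block stays there after adding [e], because [f + e < a]; hence the
   move [a] reaches a P-position. *)
rewrite even_block_lt2 // in nev; last lia.
rewrite Pa; last lia.
by rewrite fyE even_block_lt2 //; lia.
Qed.

Lemma enters_next T f : f < a -> enters T f ->
  enters (T + active_length f + b) (if f + e < a then f + e else f + e - a).
Proof.
move=> lt_fa ent; have le2ab := le_2a_b; have cyc := large_cycle T f lt_fa ent.
have le_bL : b <= active_length f by rewrite /active_length; case: ifP; lia.
split=> y lt_y.
  rewrite (P_optionE b _ (T + (active_length f + y))); last lia.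
  by rewrite cyc ?ltnNge ?leq_addr //; lia.
rewrite (P_optionE _ _ (T + (active_length f + y - a))); last lia.
rewrite cyc; last lia.
rewrite (_ : active_length f + y - a < active_length f) /=; last lia.
rewrite addnBA; last lia.
rewrite /active_length; case: (ltnP (f + e)) => [lt_fea|le_afe].
  rewrite even_blockB //; last lia.
  rewrite (_ : f + (b + y) = f + y + b); last lia.
  rewrite even_blockDb even_block_lt2 //; lia.
rewrite (_ : f + (b + a + y) - a = f + y + b); last lia.
rewrite even_blockDb (_ : f + y + e = f + e - a + y + a); last lia.
rewrite even_blockD // even_block_lt2 //; lia.
Qed.

(** [j * e %/ a] counts the earlier cycles whose phase wraps around; each of them is longer by
    [a]. *)
Definition cycle_start j := 2 * b * j + a * (j * e %/ a).
Definition phase j := j * e %% a.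

Lemma phase_lt j : phase j < a. Proof. exact: ltn_pmod. Qed.

Lemma cycle_startS j :
  cycle_start j.+1 = cycle_start j + active_length (phase j) + b.
Proof.
rewrite /cycle_start /active_length /phase (mulSnr j) divnD // (divn_small e_lt).
rewrite (modn_small e_lt); move: (_ %/ a) (_ %% a) => q r.
by case: (ltnP (r + e) a) => _; lia.
Qed.

Lemma phaseS j :
  phase j.+1 = if phase j + e < a then phase j + e else phase j + e - a.
Proof.
rewrite /phase (mulSnr j) modnD // (modn_small e_lt).
by case: (ltnP (_ + e)) => _; rewrite ?mul0n ?mul1n ?subn0.
Qed.

Lemma enters_cycle j : enters (cycle_start j) (phase j).
Proof.
elim: j => [|j IHj]; last by rewrite cycle_startS phaseS; apply: enters_next (phase_lt j) IHj.
rewrite /cycle_start /phase !mul0n mod0n div0n !muln0.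
split=> y lt_y; rewrite /P_option !add0n; first by rewrite leqNgt lt_y.
by rewrite !(leqNgt _ y) lt_y ltn_addr.
Qed.

Lemma large_P j y : y < active_length (phase j) + b ->
  P (cycle_start j + y) = (y < active_length (phase j)) && even_block a (phase j + y).
Proof. exact: large_cycle (phase_lt j) (enters_cycle j) y. Qed.

Lemma cycleP x : exists j y, x = cycle_start j + y /\ y < active_length (phase j) + b.
Proof.
have b_gt0 : 0 < b by have := le_2a_b; lia.
elim: x => [|x [j [y [-> lt_y]]]].
  exists 0, 0; rewrite /cycle_start mul0n div0n !muln0; split=> //; lia.
have [lt_y1|le_y1] := ltnP y.+1 (active_length (phase j) + b).
  by exists j, y.+1; rewrite addnS.
exists j.+1, 0; rewrite cycle_startS; split; lia.
Qed.

Lemma P_cycle_start j : P (cycle_start j).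
Proof.
have le2ab := le_2a_b; rewrite -[cycle_start j]addn0 large_P; last lia.
have lt := phase_lt j; rewrite addn0 even_block_lt2 ?lt ?andbT //; last lia.
by rewrite /active_length; case: ifP; lia.
Qed.

(** A P-position at offset [y > 0] in its cycle has another one at most [b] before it: the cycle
    start if [y <= b], and otherwise the position [2 * a] earlier, two blocks back, as
    [2 * a <= b]. *)
Lemma P_after_run x : P x -> (forall i, 0 < i <= b -> P (x - i) = false) ->
  exists j, x = cycle_start j.
Proof.
have le2ab := le_2a_b; have [j [y [-> lt_y]]] := cycleP x => Px run.
exists j; case: (posnP y) => [->|y_gt0]; first by rewrite addn0.
have [le_yb|lt_by] := leqP y b.
  by have := run y; rewrite addnK P_cycle_start y_gt0 le_yb => /(_ isT).
have := run (2 * a); rewrite -addnBA; last lia.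
move=> /(_ _)/negbT; rewrite large_P; last lia.
move: Px; rewrite large_P // => /andP[lt_yL ev].
rewrite (_ : y - 2 * a < _) /=; last lia.
rewrite (_ : phase j + (y - 2 * a) = phase j + y - a - a); last lia.
rewrite !even_blockB ?ev //; lia.
Qed.

Let n := a %/ gcdn a e.
Let p := n * (2 * b + e).

Lemma n_mulE : n * e = a * (e %/ gcdn a e).
Proof. by rewrite /n divn_mulAC ?dvdn_gcdl // muln_divA ?dvdn_gcdr. Qed.

Lemma cycle_startD_n j : cycle_start (j + n) = cycle_start j + p.
Proof.
rewrite /cycle_start /p mulnDl n_mulE (mulnC a (e %/ _)) divnDMl //.
rewrite [n * _]mulnDr n_mulE; move: (_ %/ a) (_ %/ gcdn a e) => q r; lia.
Qed.

Lemma phaseD_n j : phase (j + n) = phase j.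
Proof. by rewrite /phase mulnDl n_mulE (mulnC a) addnC modnMDl. Qed.

(** Phase 0 means that [a] divides [j * e]. The start is then [j * (2 * b + e)], and [n] divides [j]
    because it is coprime to [e %/ gcdn a e]. *)
Lemma phase0_dvd j : phase j = 0 -> p %| cycle_start j.
Proof.
move=> f0; have a_je : a %| j * e by rewrite /dvdn -/(phase j) f0.
have -> : cycle_start j = j * (2 * b + e).
  by rewrite /cycle_start mulnC [a * _]mulnC divnK // mulnDr mulnC; lia.
rewrite /p dvdn_pmul2r; last lia.
have g_gt0 : 0 < gcdn a e by rewrite gcdn_gt0 a_gt0.
rewrite -(@Gauss_dvdl _ _ (e %/ gcdn a e)).
  by rewrite -(dvdn_pmul2r g_gt0) /n -mulnA !divnK ?dvdn_gcdl ?dvdn_gcdr.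
by rewrite /coprime -(eqn_pmul2r g_gt0) muln_gcdl !divnK ?dvdn_gcdl ?dvdn_gcdr ?mul1n.
Qed.

Lemma large_period_length : is_period_length P p.
Proof.
have le2ab := le_2a_b.
have n_gt0 : 0 < n by rewrite divn_gt0 ?gcdn_gt0 ?a_gt0 // dvdn_leq ?dvdn_gcdl.
apply: is_period_lengthI => [|x|x Px].
- by rewrite muln_gt0 n_gt0; lia.
- have [j [y [-> lt_y]]] := cycleP x.
  by rewrite addnAC -cycle_startD_n !large_P ?phaseD_n.
have start0 : cycle_start 0 = 0 by rewrite /cycle_start mul0n div0n !muln0.
have phase0 : phase 0 = 0 by rewrite /phase mul0n mod0n.
have startn : cycle_start n = p by rewrite -[n]add0n cycle_startD_n start0.
have le_bp : b <= p by rewrite /p; nia.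
(* With [x + p] in place of [x], the run to inspect is the translate by [x] of the one before [p],
   and no subtraction is truncated. *)
have [|i /andP[i_gt0 le_ib]|j xpE] := P_after_run (x + p).
- by rewrite Px -startn P_cycle_start.
- rewrite -addnBA ?Px; last lia.
  have [run _] := enters_cycle n.
  have := run (b - i); rewrite startn (P_optionE b _ (p - i)); last lia.
  by apply; lia.
have le_bL k : b <= active_length k by rewrite /active_length; case: ifP; lia.
(* The position [a.-1] after a cycle start belongs to the first block only if no P-position is
   missing from it, so the phase 0 can be read off the outcomes. *)
have first_block k : P (cycle_start k + a.-1) = (phase k == 0).
  have := le_bL (phase k); have := phase_lt k => lt_k le_k.
  rewrite large_P; last lia.
  rewrite even_block_lt2 //; lia.
have : p %| x + p.
  rewrite xpE phase0_dvd //; apply/eqP.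
  rewrite -first_block -xpE -addnA Px -startn first_block.
  by rewrite -[n]add0n phaseD_n phase0.
by rewrite dvdn_addl.
Qed.

End LargeResidue.

End AdditiveGame.

(** * Transfer to the outcome sequence *)

Lemma eq_is_period_length (T U : Type) (f : nat -> T) (g : nat -> U) p :
  (forall x y, f x = f y <-> g x = g y) ->
  is_period_length f p -> is_period_length g p.
Proof.
move=> fg [[p_gt0 [x0 fp]] pmin]; split.
  by split=> //; exists x0 => x le_x; apply/fg/fp.
move=> q [q_gt0 [x1 gq]]; apply: pmin; split=> //.
by exists x1 => x le_x; apply/fg/gq.
Qed.

Lemma is_Pout_rec m delta x : 0 < m ->
  let P y := is_Pout (o_wall (S_additive m delta) y) in
  P x = ~~ [|| P_option P m x, P_option P (m + delta) x
             | P_option P (m + (m + delta)) x].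
Proof.
move=> m_gt0 P; have S0 : 0 \notin S_additive m delta by rewrite !inE; lia.
have -> : P x = ~~ has P (wall_options (S_additive m delta) x).
  have Pout_P y : o_wall (S_additive m delta) y = Pout <-> P y.
    by rewrite /P; case: (o_wall _ y).
  apply/idP/hasPn => [/Pout_P/(o_wallP x S0) noP y /noP oy | noP].
    by apply/negP => /Pout_P.
  by apply/Pout_P/(o_wallP x S0) => y /noP/negP ny /Pout_P.
rewrite /wall_options has_map has_filter -filter_predI -has_filter /=.
by rewrite orbF addnA mul2n addnn /P_option ![P _ && _]andbC.
Qed.

Theorem corollary4 (m delta : nat) (hm : 1 <= m) (hdelta : 1 <= delta) :
  is_period_length (o_wall (S_additive m delta)) (additive_period m delta).
Proof.
apply: (@eq_is_period_length _ _ (fun x => is_Pout (o_wall (S_additive m delta) x))).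
  by move=> x y; case: (o_wall _ x); case: (o_wall _ y).
have P_rec x := is_Pout_rec m delta x hm.
rewrite /additive_period; set d := delta %% (2 * m).
have deltaE : delta = delta %/ (2 * m) * (2 * m) + d by apply: divn_eq.
have lt_d : d < 2 * m by rewrite ltn_pmod // muln_gt0.
move: (delta %/ (2 * m)) deltaE => k deltaE.
(* Here [m + delta] equals [(2 * k).+1 * m + d], which for [m < d] is [2 * k.+1 * m + (d - m)];
   hence [h = k.+1] and [e = d - m]. *)
case: leqP => [le_dm|lt_md].
  have -> : 3 * m + 2 * delta - d = m + (m + delta) + (2 * k).+1 * m by nia.
  by apply: (@small_period_length m (m + delta) _ hm P_rec k d le_dm); nia.
have -> : m * (m + 2 * delta + d) %/ gcdn m d
        = m %/ gcdn m (d - m) * (2 * (m + delta) + (d - m)).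
  have -> : gcdn m d = gcdn m (d - m) by rewrite -{1}(subnK (ltnW lt_md)) gcdnDr.
  rewrite divn_mulAC ?dvdn_gcdl //; congr (_ * _ %/ _); lia.
by apply: (@large_period_length m (m + delta) _ hm P_rec k.+1 (d - m)) => //; nia.
Qed.
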